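(* Assume $\Sigma_w\succ0$, $W^{(1)}\succ0$, $W^{(2)}\succ0$, $\Sigma_0\succ0$ and $\beta>b_0:=\min_{\pi\in\Pi}\operatorname{Tr}(W^{(2)}\Sigma^{\pi})$. The function $f(\Sigma)=\operatorname{Tr}\big(W^{(1)}(\Sigma_0+\Sigma)^{-1}\big)$ is convex and differentiable on the cone of positive semidefinite $d\times d$ matrices, with $$\nabla f(\Sigma)=-(\Sigma_0+\Sigma)^{-1}W^{(1)}(\Sigma_0+\Sigma)^{-1}\prec0 .$$ Its gradient is $L$-Lipschitz with respect to $\|\cdot\|_F$ on $\{\Sigma\succeq0\}$ with $$L=\frac{2\|W^{(1)}\|_2}{\lambda_{\min}^3(\Sigma_0)},$$ and $f$ is $m_f$-strongly convex on $\mathcal{D}$ with respect to $\|\cdot\|_F$ with $$m_f=\frac{2\lambda_{\min}(W^{(1)})}{\big(\lambda_{\max}(\Sigma_0)+\beta/\mu\big)^3},\qquad \mu=\lambda_{\min}(W^{(2)}).$$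
   Context: Setting. Consider $x_{t+1}=Ax_t+Bu_t+w_t$, $x_0=0$, $t=0,\dots,H-1$, with $H$ a positive integer, $x_t\in\mathbb{R}^n$, $u_t\in\mathbb{R}^m$, $A\in\mathbb{R}^{n\times n}$, $B\in\mathbb{R}^{n\times m}$. The disturbances $w_t$ are i.i.d., zero mean, with covariance $\Sigma_w\succ0$. $\Pi$ is the set of causal, possibly randomized policies $\pi$: $u_t\sim\pi_t(x_0,\dots,x_t)$, where the internal randomization is independent of future disturbances $w_t,w_{t+1},\dots$; only policies for which the covariance below is finite are considered. Put $z_t=[x_t^\top\ u_t^\top]^\top\in\mathbb{R}^d$, $d=n+m$, and $$\Sigma^{\pi}=\mathbb{E}^{\pi}\Big[\sum_{t=0}^{H-1}z_tz_t^\top\Big]\succeq0 .$$ Let $\mathcal{C}=\{\Sigma^{\pi}:\pi\in\Pi\}$ and $\mathcal{D}=\{\Sigma\in\mathcal{C}:\operatorname{Tr}(W^{(2)}\Sigma)\le\beta\}$. The matrices $W^{(1)},W^{(2)},\Sigma_0$ are symmetric $d\times d$ and $\beta>0$. Gradients are with respect to the inner product $\langle X,Y\rangle=\operatorname{Tr}(X^\top Y)$ on symmetric matrices. $\|\cdot\|_2$ is the spectral norm and $\|\cdot\|_F$ the Frobenius norm. The strong convexity constant is denoted $m_f$ to distinguish it from the input dimension $m$. *)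

(* Defs.v *)
From HB Require Import structures.
From mathcomp Require Import all_boot all_order all_algebra.
From mathcomp Require Import all_classical all_reals all_analysis.

Set Implicit Arguments.
Unset Strict Implicit.
Unset Printing Implicit Defensive.

Import Order.TTheory GRing.Theory Num.Theory.
Import numFieldNormedType.Exports.

Local Open Scope classical_set_scope.
Local Open Scope ring_scope.

Section Matrices.
Variable R : realType.

Definition frob p q (X Y : 'M[R]_(p, q)) : R := \tr (X^T *m Y).

(* On column vectors ('M_(p, 1)) this is the Euclidean norm. *)
Definition fnorm p q (X : 'M[R]_(p, q)) : R := Num.sqrt (frob X X).

Definition specnorm p q (X : 'M[R]_(p, q)) : R :=
  sup [set fnorm (X *m v) | v in [set v : 'cV[R]_q | fnorm v <= 1]].

Definition symmetric d (S : 'M[R]_d) : Prop := S^T = S.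

Definition possemidef d (S : 'M[R]_d) : Prop :=
  symmetric S /\ forall v : 'cV[R]_d, 0 <= (v^T *m S *m v) 0 0.

Definition posdef d (S : 'M[R]_d) : Prop :=
  symmetric S /\ forall v : 'cV[R]_d, v != 0 -> 0 < (v^T *m S *m v) 0 0.

Definition negdef d (S : 'M[R]_d) : Prop := posdef (- S).

Definition lambda_min d (S : 'M[R]_d) : R := inf [set a | eigenvalue S a].

Definition lambda_max d (S : 'M[R]_d) : R := sup [set a | eigenvalue S a].

(* Frechet gradient of f at S on the space of symmetric matrices equipped with
   the inner product frob.  Increments range over a full neighbourhood of 0 in
   that space, so at boundary points of the semidefinite cone this is two-sided
   differentiability rather than differentiability relative to the cone. *)
Definition is_gradient d (f : 'M[R]_d -> R) (S G : 'M[R]_d) : Prop :=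
  symmetric G /\
  forall e : R, 0 < e -> exists2 delta : R, 0 < delta &
    forall D : 'M[R]_d, symmetric D -> fnorm D < delta ->
      `| f (S + D) - f S - frob G D | <= e * fnorm D.

Definition strongly_convex_on d (K : set 'M[R]_d) (c : R) (f : 'M[R]_d -> R) :
  Prop :=
  forall (X Y : 'M[R]_d) (t : R), K X -> K Y -> 0 <= t <= 1 ->
    f (t *: X + (1 - t) *: Y) <=
      t * f X + (1 - t) * f Y - c / 2 * t * (1 - t) * fnorm (X - Y) ^+ 2.

Definition is_minimum (E : set R) (b : R) : Prop := E b /\ lbound E b.

Definition fobj d (W S0 S : 'M[R]_d) : R := \tr (W *m invmx (S0 + S)).

Definition fgrad d (W S0 S : 'M[R]_d) : 'M[R]_d :=
  - (invmx (S0 + S) *m W *m invmx (S0 + S)).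

End Matrices.

(* R^n with its Borel sigma-algebra. *)
Definition vec (R : realType) (n : nat) :=
  g_sigma_algebraType (@open 'cV[R]_n).

Section Probability.
Variable R : realType.

Definition mx_integrable d (T : measurableType d) (P : probability T R) p q
    (M : T -> 'M[R]_(p, q)) : Prop :=
  forall i j, P.-integrable [set: T] (fun w => (M w i j)%:E).

(* Entrywise; meaningful only under mx_integrable. *)
Definition mx_expectation d (T : measurableType d) (P : probability T R) p q
    (M : T -> 'M[R]_(p, q)) : 'M[R]_(p, q) :=
  \matrix_(i, j) fine ('E_P[fun w => M w i j])%E.

Definition zero_mean n (nu : probability (vec R n) R) : Prop :=
  mx_integrable nu (fun w => w : 'cV[R]_n) /\
  mx_expectation nu (fun w => w : 'cV[R]_n) = 0.

Definition has_covariance n (nu : probability (vec R n) R) (V : 'M[R]_n) :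
    Prop :=
  let c := fun w : vec R n =>
    (w : 'cV[R]_n) - mx_expectation nu (fun w => w : 'cV[R]_n) in
  mx_integrable nu (fun w => c w *m (c w)^T) /\
  mx_expectation nu (fun w => c w *m (c w)^T) = V.

Definition independent d d1 d2 (T : measurableType d) (T1 : measurableType d1)
    (T2 : measurableType d2) (P : probability T R) (X : T -> T1) (Y : T -> T2) :
    Prop :=
  forall (E : set T1) (F : set T2), measurable E -> measurable F ->
    P (X @^-1` E `&` Y @^-1` F) = (P (X @^-1` E) * P (Y @^-1` F))%E.

(* Taking some of the E i to be the full space gives the product rule for every
   subfamily. *)
Definition mutually_independent d d' (T : measurableType d)
    (T' : measurableType d') (P : probability T R) (I : finType)
    (X : I -> T -> T') : Prop :=
  forall E : I -> set T', (forall i, measurable (E i)) ->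
    P (\bigcap_(i in [set: I]) (X i @^-1` E i)) =
    (\prod_(i : I) P (X i @^-1` E i))%E.

End Probability.

Section Control.
Variables (R : realType) (n m H : nat).

(* pi t is the conditional law of u_t given (x_0, ..., x_t). *)
Definition policy : Type :=
  forall t : 'I_H, R.-pker (t.+1.-tuple (vec R n)) ~> (vec R m).

Section Trajectory.
Variables (d : measure_display) (T : measurableType d) (P : probability T R).
Variables (x w : nat -> {RV P >-> vec R n}) (u : nat -> {RV P >-> vec R m}).

Definition state_history (t : nat) (o : T) : t.+1.-tuple (vec R n) :=
  [tuple x s o | s < t.+1].

Definition input_history (t : nat) (o : T) : t.+1.-tuple (vec R m) :=
  [tuple u s o | s < t.+1].

Definition noise_future (t : nat) (o : T) : (H - t).-tuple (vec R n) :=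
  [tuple w (t + s)%N o | s < H - t].

(* (x, u, w) is a trajectory over the horizon H, with disturbance law nu, driven
   by the policy pi.  The law of u_t is only prescribed conditionally on the
   states, so the internal randomization may be correlated over time; it must
   however leave the whole past, u_t included, independent of w_t, w_{t+1}, ... *)
Record closed_loop (A : 'M[R]_n) (B : 'M[R]_(n, m))
    (nu : probability (vec R n) R) (pi : policy) : Prop := {
  cl_init : forall o, x 0%N o = 0 :> 'cV[R]_n ;
  cl_step : forall t o, (t < H)%N ->
    x t.+1 o = A *m (x t o : 'cV[R]_n) + B *m (u t o : 'cV[R]_m)
               + (w t o : 'cV[R]_n) :> 'cV[R]_n ;
  cl_noise_law : forall (t : 'I_H) (E : set (vec R n)), measurable E ->
    P (w t @^-1` E) = nu E ;
  cl_noise_indep : mutually_independent P (fun t : 'I_H => w t : T -> vec R n) ;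
  cl_causal : forall t : 'I_H,
    independent P (fun o => (state_history t o, input_history t o))
      (noise_future t) ;
  cl_input : forall (t : 'I_H) (E : set (t.+1.-tuple (vec R n)))
      (F : set (vec R m)), measurable E -> measurable F ->
    P (state_history t @^-1` E `&` u t @^-1` F) =
    (\int[P]_(o in state_history t @^-1` E) pi t (state_history t o) F)%E
}.

Definition stacked (t : nat) (o : T) : 'cV[R]_(n + m) :=
  col_mx (x t o : 'cV[R]_n) (u t o : 'cV[R]_m).

Definition sum_outer (o : T) : 'M[R]_(n + m) :=
  \sum_(t < H) stacked t o *m (stacked t o)^T.

End Trajectory.

(* S = Sigma^pi, with finite entries.  The joint law of (x_0, ..., x_t, u_t) is
   determined by pi, nu, A and B, so S does not depend on the realization. *)
Definition policy_covariance (A : 'M[R]_n) (B : 'M[R]_(n, m))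
    (nu : probability (vec R n) R) (pi : policy) (S : 'M[R]_(n + m)) : Prop :=
  exists (d : measure_display) (T : measurableType d) (P : probability T R)
    (x w : nat -> {RV P >-> vec R n}) (u : nat -> {RV P >-> vec R m}),
    [/\ closed_loop x w u A B nu pi,
        mx_integrable P (sum_outer x u) &
        S = mx_expectation P (sum_outer x u)].

Definition covariances (A : 'M[R]_n) (B : 'M[R]_(n, m))
    (nu : probability (vec R n) R) : set 'M[R]_(n + m) :=
  [set S | exists pi : policy, policy_covariance A B nu pi S].

Definition budgeted_covariances (A : 'M[R]_n) (B : 'M[R]_(n, m))
    (nu : probability (vec R n) R) (W : 'M[R]_(n + m)) (beta : R) :
    set 'M[R]_(n + m) :=
  covariances A B nu `&` [set S | \tr (W *m S) <= beta].

End Control.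

(* Main.v *)
Require Import Defs.
From HB Require Import structures.
From mathcomp Require Import all_boot all_order all_algebra.
From mathcomp Require Import all_classical all_reals all_analysis.
From mathcomp Require Import ring lra zify.

Set Implicit Arguments.
Unset Strict Implicit.
Unset Printing Implicit Defensive.

Import Order.TTheory GRing.Theory Num.Theory.
Import numFieldNormedType.Exports.
(* [symmetric] is to denote symmetry of a matrix, not that of a relation. *)
Import Defs.

Local Open Scope classical_set_scope.
Local Open Scope ring_scope.

(** Everything rests on one exact identity.  Put [P = S0 + S] and
    [f S = \tr (W P^-1)].  Whenever [P] and [P + D] are invertible,
      [(P + D)^-1 = P^-1 - P^-1 D P^-1 + P^-1 D (P + D)^-1 D P^-1],
    so that [f (S + D) = f S + <grad f S, D> + r] with the remainder
      [r = \tr (W P^-1 D (P + D)^-1 D P^-1)] ([fobj_expansion]).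
    No calculus is needed after this: each claim on [f] is an estimate of [r].
    - [r] is the trace of a product of two semidefinite matrices, hence
      nonnegative ([remainder_ge0]): [f] lies above its tangents and is convex.
    - By Cauchy-Schwarz [r] is [O(|D|^2)] ([remainder_upper]), which identifies
      the gradient.
    - If [w <= W] and [P, P + D <= M] in the semidefinite order, then
      [w / M^3 |D|^2 <= r] ([remainder_lower]); this is strong convexity with
      constant [2 w / M^3].  On the budgeted set one may take
      [M = lambda_max S0 + beta / mu], because [S <= \tr S] for semidefinite [S]
      and [mu \tr S <= \tr (W2 S) <= beta].
    The control problem enters through the semidefiniteness of covariances
    ([covariance_psd]), expectations of sums of matrices [z z^T].

    The Lipschitz bound comes from [P^-1 - Q^-1 = - P^-1 (P - Q) Q^-1], which
    splits the difference of two gradients into two products, each containing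
    the increment once, [W] once, and three inverses of norm at most
    [1 / lambda_min S0].

    Two facts of linear algebra carry the estimates.  First, [0 <= \tr (S T)]
    for semidefinite [S] and [T] ([psd_trace_mul_ge0]), by subtracting rank-one
    matrices from [T].  Second, [lambda_min S <= S <= lambda_max S] for symmetric
    [S] ([lambda_min_lower], [lambda_max_upper]): the largest [l] for which
    [S - l] is semidefinite is an eigenvalue, since a semidefinite invertible
    matrix is bounded below by a positive multiple of the identity.

    Semidefinite inequalities [c <= S] and [S <= c] are written
    [possemidef (S - c%:M)] and [possemidef (c%:M - S)]. *)

(** * The Frobenius inner product *)

Section FrobeniusForm.
Variable R : realType.

Lemma frobC p q (X Y : 'M[R]_(p, q)) : frob X Y = frob Y X.
Proof. by rewrite /frob -mxtrace_tr trmx_mul trmxK. Qed.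

Lemma frobDr p q (X Y Z : 'M[R]_(p, q)) : frob X (Y + Z) = frob X Y + frob X Z.
Proof. by rewrite /frob mulmxDr raddfD. Qed.

Lemma frobNr p q (X Y : 'M[R]_(p, q)) : frob X (- Y) = - frob X Y.
Proof. by rewrite /frob mulmxN raddfN. Qed.

Lemma frobZr p q c (X Y : 'M[R]_(p, q)) : frob X (c *: Y) = c * frob X Y.
Proof. by rewrite /frob -scalemxAr linearZ. Qed.

Lemma frobDl p q (X Y Z : 'M[R]_(p, q)) : frob (X + Y) Z = frob X Z + frob Y Z.
Proof. by rewrite frobC frobDr ![frob Z _]frobC. Qed.

Lemma frobNl p q (X Y : 'M[R]_(p, q)) : frob (- X) Y = - frob X Y.
Proof. by rewrite frobC frobNr frobC. Qed.

Lemma frobZl p q c (X Y : 'M[R]_(p, q)) : frob (c *: X) Y = c * frob X Y.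
Proof. by rewrite frobC frobZr frobC. Qed.

Lemma frob_mulmxl p q r (A : 'M[R]_(p, q)) (X : 'M[R]_(q, r)) (Y : 'M[R]_(p, r)) :
  frob (A *m X) Y = frob X (A^T *m Y).
Proof. by rewrite /frob trmx_mul mulmxA. Qed.

Lemma frob_tr p q (X Y : 'M[R]_(p, q)) : frob X^T Y^T = frob X Y.
Proof. by rewrite frobC /frob trmxK mxtrace_mulC. Qed.

Lemma frob_trace p (X Y : 'M[R]_p) : symmetric X -> frob X Y = \tr (X *m Y).
Proof. by rewrite /frob => ->. Qed.

Lemma frob_cV p (u v : 'cV[R]_p) : frob u v = (u^T *m v) 0 0.
Proof. by rewrite /frob trace_mx11. Qed.

Lemma frobE p q (X Y : 'M[R]_(p, q)) : frob X Y = \sum_j \sum_i X i j * Y i j.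
Proof.
by apply: eq_bigr => j _; rewrite mxE; apply: eq_bigr => i _; rewrite mxE.
Qed.

Lemma frob_ge0 p q (X : 'M[R]_(p, q)) : 0 <= frob X X.
Proof.
by rewrite frobE; do 2![apply: sumr_ge0 => ? _]; rewrite -expr2 sqr_ge0.
Qed.

Lemma frob_eq0 p q (X : 'M[R]_(p, q)) : (frob X X == 0) = (X == 0).
Proof.
apply/eqP/eqP => [|->]; last by rewrite /frob mulmx0 raddf0.
rewrite frobE => X0; apply/matrixP => i j; rewrite mxE; apply/eqP.
have sq_ge0 k l : 0 <= X k l * X k l by rewrite -expr2 sqr_ge0.
have /(_ j isT) Xj := psumr_eq0P (fun l _ => sumr_ge0 _ (fun k _ => sq_ge0 k l)) X0.
have /(_ i isT) /eqP := psumr_eq0P (fun k _ => sq_ge0 k j) Xj.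
by rewrite -expr2 sqrf_eq0.
Qed.

Lemma frob_gt0 p q (X : 'M[R]_(p, q)) : X != 0 -> 0 < frob X X.
Proof. by rewrite -frob_eq0 lt0r frob_ge0 andbT. Qed.

Lemma fnorm_ge0 p q (X : 'M[R]_(p, q)) : 0 <= fnorm X.
Proof. exact: sqrtr_ge0. Qed.

Lemma sqr_fnorm p q (X : 'M[R]_(p, q)) : fnorm X ^+ 2 = frob X X.
Proof. by rewrite /fnorm sqr_sqrtr ?frob_ge0. Qed.

Lemma fnorm_tr p q (X : 'M[R]_(p, q)) : fnorm X^T = fnorm X.
Proof. by rewrite /fnorm frob_tr. Qed.

Lemma fnormZ p q c (X : 'M[R]_(p, q)) : fnorm (c *: X) = `|c| * fnorm X.
Proof.
by rewrite /fnorm frobZr frobZl mulrA -expr2 sqrtrM ?sqr_ge0// sqrtr_sqr.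
Qed.

Lemma fnorm0 p q : fnorm (0 : 'M[R]_(p, q)) = 0.
Proof. by rewrite /fnorm /frob mulmx0 raddf0 sqrtr0. Qed.

Lemma fnorm_eq0 p q (X : 'M[R]_(p, q)) : (fnorm X == 0) = (X == 0).
Proof. by rewrite -sqrf_eq0 sqr_fnorm frob_eq0. Qed.

Lemma fnorm_gt0 p q (X : 'M[R]_(p, q)) : X != 0 -> 0 < fnorm X.
Proof. by rewrite -fnorm_eq0 lt0r fnorm_ge0 andbT. Qed.

Lemma ler_fnorm p q r s c (X : 'M[R]_(p, q)) (Y : 'M[R]_(r, s)) : 0 <= c ->
  (fnorm X <= c * fnorm Y) = (frob X X <= c ^+ 2 * frob Y Y).
Proof.
move=> c0; rewrite -!sqr_fnorm -exprMn.
by rewrite ler_pXn2r ?nnegrE ?mulr_ge0 ?fnorm_ge0.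
Qed.

End FrobeniusForm.

(** * Semidefinite matrices and Cauchy-Schwarz *)

Section Semidefinite.
Variable R : realType.

Lemma psdI d (S : 'M[R]_d) : symmetric S ->
  (forall v : 'cV[R]_d, 0 <= frob v (S *m v)) -> possemidef S.
Proof. by move=> symS S0; split=> // v; rewrite -mulmxA -frob_cV. Qed.

(** The quadratic form of [S] on a matrix is the sum of its values on the columns.
    Allowing matrices as arguments makes one Cauchy-Schwarz inequality serve both
    for vectors and for Frobenius norms. *)
Lemma psd_frob d p (S : 'M[R]_d) (X : 'M[R]_(d, p)) :
  possemidef S -> 0 <= frob X (S *m X).
Proof.
move=> [_ S0]; apply: sumr_ge0 => j _.
suff -> : (X^T *m (S *m X)) j j = ((col j X)^T *m S *m col j X) 0 0 by [].
rewrite -mulmxA [LHS]mxE [RHS]mxE; apply: eq_bigr => i _; rewrite !mxE; congr (_ * _).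
by apply: eq_bigr => k _; rewrite !mxE.
Qed.

Lemma posdef_frob d (S : 'M[R]_d) (v : 'cV[R]_d) :
  posdef S -> v != 0 -> 0 < frob v (S *m v).
Proof. by move=> [_ S0] /S0; rewrite -mulmxA -frob_cV. Qed.

Lemma posdef_psd d (S : 'M[R]_d) : posdef S -> possemidef S.
Proof.
move=> pdS; apply: psdI => [|v]; first by case: pdS.
have [->|/(posdef_frob pdS)/ltW//] := eqVneq v 0.
by rewrite mulmx0 /frob mulmx0 raddf0.
Qed.

Lemma symmetricD d (S T : 'M[R]_d) : symmetric S -> symmetric T -> symmetric (S + T).
Proof. by rewrite /symmetric raddfD /= => -> ->. Qed.

Lemma symmetricN d (S : 'M[R]_d) : symmetric S -> symmetric (- S).
Proof. by rewrite /symmetric raddfN /= => ->. Qed.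

Lemma symmetricZ d c (S : 'M[R]_d) : symmetric S -> symmetric (c *: S).
Proof. by rewrite /symmetric linearZ /= => ->. Qed.

Lemma symmetric_scalar d c : symmetric (c%:M : 'M[R]_d).
Proof. exact: tr_scalar_mx. Qed.

Lemma symmetric_inv d (S : 'M[R]_d) : symmetric S -> symmetric (invmx S).
Proof. by rewrite /symmetric trmx_inv => ->. Qed.

Lemma symmetric_congr d p (S : 'M[R]_d) (X : 'M[R]_(d, p)) :
  symmetric S -> symmetric (X^T *m S *m X).
Proof. by rewrite /symmetric !trmx_mul trmxK => ->; rewrite mulmxA. Qed.

Lemma psdD d (S T : 'M[R]_d) : possemidef S -> possemidef T -> possemidef (S + T).
Proof.
move=> psdS psdT; apply: psdI => [|v].
  by apply: symmetricD; [case: psdS | case: psdT].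
by rewrite mulmxDl frobDr addr_ge0 ?psd_frob.
Qed.

Lemma psdZ d c (S : 'M[R]_d) : 0 <= c -> possemidef S -> possemidef (c *: S).
Proof.
move=> c0 psdS; apply: psdI => [|v]; first by apply: symmetricZ; case: psdS.
by rewrite -scalemxAl frobZr mulr_ge0 ?psd_frob.
Qed.

Lemma posdefD d (S T : 'M[R]_d) : posdef S -> possemidef T -> posdef (S + T).
Proof.
move=> pdS psdT; split=> [|v v0].
  by apply: symmetricD; [case: pdS | case: psdT].
rewrite -mulmxA -frob_cV mulmxDl frobDr.
by rewrite ltr_wpDr ?psd_frob ?posdef_frob.
Qed.

Lemma psd_congr d p (S : 'M[R]_d) (X : 'M[R]_(d, p)) :
  possemidef S -> possemidef (X^T *m S *m X).
Proof.
move=> psdS; apply: psdI => [|v]; first by apply: symmetric_congr; case: psdS.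
by rewrite -!mulmxA -frob_mulmxl psd_frob.
Qed.

Lemma psd1 d : possemidef (1%:M : 'M[R]_d).
Proof.
by apply: psdI => [|v]; rewrite ?mul1mx ?frob_ge0//; exact: symmetric_scalar.
Qed.

Lemma psd_outer p q (X : 'M[R]_(p, q)) : possemidef (X *m X^T).
Proof. by have := psd_congr X^T (psd1 q); rewrite trmxK mulmx1. Qed.

Lemma psd_lowerP d c (S : 'M[R]_d) : symmetric S ->
  possemidef (S - c%:M) <-> forall v : 'cV[R]_d, c * frob v v <= frob v (S *m v).
Proof.
move=> symS; split=> [psdS v|bS].
  have := psd_frob v psdS.
  by rewrite mulmxBl mul_scalar_mx frobDr frobNr frobZr subr_ge0.
apply: psdI => [|v]; last first.
  by rewrite mulmxBl mul_scalar_mx frobDr frobNr frobZr subr_ge0.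
by apply: symmetricD => //; apply/symmetricN/symmetric_scalar.
Qed.

Lemma psd_lower d p c (S : 'M[R]_d) (X : 'M[R]_(d, p)) :
  possemidef (S - c%:M) -> c * frob X X <= frob X (S *m X).
Proof.
move=> /(psd_frob X).
by rewrite mulmxBl mul_scalar_mx frobDr frobNr frobZr subr_ge0.
Qed.

Lemma psd_upper d p c (S : 'M[R]_d) (X : 'M[R]_(d, p)) :
  possemidef (c%:M - S) -> frob X (S *m X) <= c * frob X X.
Proof.
move=> /(psd_frob X).
by rewrite mulmxBl mul_scalar_mx frobDr frobNr frobZr subr_ge0.
Qed.

Lemma discriminant_le (a b c : R) : 0 <= c ->
  (forall t, 0 <= a + 2 * b * t + c * t ^+ 2) -> b ^+ 2 <= a * c.
Proof.
rewrite le_eqVlt => /predU1P[<-|c0] H.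
  have [->|b0] := eqVneq b 0; first by lra.
  (* an affine function with nonzero slope takes the value -1 *)
  have := H (- (a + 1) / (2 * b)).
  have -> : a + 2 * b * (- (a + 1) / (2 * b)) + 0 * (- (a + 1) / (2 * b)) ^+ 2 = -1.
    by field.
  by lra.
(* the minimizer *)
have := H (- b / c).
have -> : a + 2 * b * (- b / c) + c * (- b / c) ^+ 2 = (a * c - b ^+ 2) / c.
  by field; lra.
by rewrite pmulr_lge0 ?invr_gt0// subr_ge0.
Qed.

(** The quadratic [t |-> <X + t Y, S (X + t Y)>] is nonnegative. *)
Lemma psd_cauchy_schwarz d p (S : 'M[R]_d) (X Y : 'M[R]_(d, p)) : possemidef S ->
  frob X (S *m Y) ^+ 2 <= frob X (S *m X) * frob Y (S *m Y).
Proof.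
move=> psdS; apply: discriminant_le => [|t]; first exact: psd_frob.
have symS : S^T = S by case: psdS.
have := psd_frob (X + t *: Y) psdS.
rewrite mulmxDr -scalemxAr !(frobDr, frobDl, frobZr, frobZl).
have -> : frob Y (S *m X) = frob X (S *m Y) by rewrite frobC frob_mulmxl symS.
by congr (0 <= _); ring.
Qed.

Lemma frob_cauchy_schwarz p q (X Y : 'M[R]_(p, q)) : `|frob X Y| <= fnorm X * fnorm Y.
Proof.
rewrite -(ler_pXn2r (n := 2)) ?nnegrE ?mulr_ge0 ?fnorm_ge0//.
have := psd_cauchy_schwarz X Y (psd1 p).
by rewrite exprMn !sqr_fnorm real_normK ?num_real// !mul1mx.
Qed.

Lemma fnormD p q (X Y : 'M[R]_(p, q)) : fnorm (X + Y) <= fnorm X + fnorm Y.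
Proof.
rewrite -(ler_pXn2r (n := 2)) ?nnegrE ?addr_ge0 ?fnorm_ge0//.
rewrite sqrrD !sqr_fnorm !(frobDr, frobDl) (frobC Y X).
have := le_trans (ler_norm _) (frob_cauchy_schwarz X Y); lra.
Qed.

End Semidefinite.

(** * The trace of a product of semidefinite matrices *)

Section TraceProduct.
Variable R : realType.

Lemma psd_kernel d p (S : 'M[R]_d) (X : 'M[R]_(d, p)) :
  possemidef S -> frob X (S *m X) = 0 -> S *m X = 0.
Proof.
move=> psdS SX0; apply/eqP; rewrite -frob_eq0; apply/eqP.
have symS : S^T = S by case: psdS.
have := psd_cauchy_schwarz X (S *m X) psdS.
rewrite SX0 mul0r.
have -> : frob X (S *m (S *m X)) = frob (S *m X) (S *m X).
  by rewrite [RHS]frob_mulmxl symS.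
by move=> le0; apply/eqP; rewrite -sqrf_eq0 eq_le le0 sqr_ge0.
Qed.

Lemma frob_outer d (u y : 'cV[R]_d) : frob u (y *m y^T *m u) = frob y u ^+ 2.
Proof.
rewrite -mulmxA [y^T *m u]mx11_scalar mul_mx_scalar.
by rewrite frobZr -frob_cV [frob u y]frobC expr2.
Qed.

(** Cauchy-Schwarz for the form of [S] is exactly the semidefiniteness of what
    remains of [S] once the rank-one matrix that agrees with it on [v] is removed. *)
Lemma psd_deflate d (S : 'M[R]_d) (v : 'cV[R]_d) :
  possemidef S -> 0 < frob v (S *m v) ->
  possemidef (S - (frob v (S *m v))^-1 *: (S *m v *m (S *m v)^T)).
Proof.
move=> psdS q_gt0; have symS : S^T = S by case: psdS.
apply: psdI => [|u].
  apply: symmetricD => //; apply/symmetricN/symmetricZ.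
  by rewrite /symmetric trmx_mul trmxK.
rewrite mulmxBl frobDr frobNr -scalemxAl frobZr subr_ge0.
rewrite mulrC ler_pdivrMr// frob_outer frobC.
exact: psd_cauchy_schwarz.
Qed.

(** Induction on the rank of [T]: deflating [T] along a vector outside its kernel
    lowers the rank, and the removed term [(T v) (T v)^T / q] contributes a
    nonnegative multiple of the form of [S] at [T v]. *)
Lemma psd_trace_mul_ge0 d (S T : 'M[R]_d) :
  possemidef S -> possemidef T -> 0 <= \tr (S *m T).
Proof.
move=> psdS; have [r] := ubnP (\rank T); elim: r T => // r IHr T.
rewrite ltnS => rkT psdT; have symT : T^T = T by case: psdT.
have [T0|] := pselect (forall v : 'cV[R]_d, T *m v = 0).
  suff -> : T = 0 by rewrite mulmx0 raddf0.
  apply/matrixP => i j; have := T0 (delta_mx j 0).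
  by rewrite -colE => /colP/(_ i); rewrite !mxE.
move=> /existsNP[v Tv0]; set q := frob v (T *m v).
have q_gt0 : 0 < q.
  by rewrite lt0r psd_frob// andbT; apply/eqP => /(psd_kernel psdT).
set T' := T - q^-1 *: (T *m v *m (T *m v)^T).
have T'v : v^T *m T' = 0.
  rewrite mulmxBr -scalemxAr trmx_mul symT !mulmxA.
  suff -> : v^T *m T *m v = q%:M.
    by rewrite mul_scalar_mx -!scalemxAl scalerA mulVf ?gt_eqF// scale1r subrr.
  by rewrite [LHS]mx11_scalar -mulmxA -frob_cV.
have rkT' : (\rank T' < \rank T)%N.
  have : (kermx T < kermx T')%MS.
    rewrite /ltmx; apply/andP; split; last first.
      apply/negP => kerT; apply: Tv0.
      apply: trmx_inj; rewrite trmx_mul symT trmx0; apply/sub_kermxP.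
      by apply: submx_trans kerT; apply/sub_kermxP.
    apply/sub_kermxP; rewrite mulmxBr -scalemxAr !mulmxA mulmx_ker.
    by rewrite !mul0mx scaler0 subrr.
  move=> /rank_ltmx; rewrite !mxrank_ker => lt_ker.
  have := rank_leq_row T'; have := rank_leq_row T; lia.
have -> : \tr (S *m T) = \tr (S *m T') + q^-1 * frob (T *m v) (S *m (T *m v)).
  have -> : frob (T *m v) (S *m (T *m v)) = \tr (S *m (T *m v *m (T *m v)^T)).
    by rewrite /frob mxtrace_mulC [in RHS]mulmxA.
  by rewrite -mxtraceZ -raddfD /= scalemxAr -mulmxDr subrK.
apply: addr_ge0.
  by apply: IHr; [exact: leq_trans rkT' rkT | exact: psd_deflate].
by rewrite mulr_ge0 ?invr_ge0 ?(ltW q_gt0)// psd_frob.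
Qed.

Lemma psd_lower_trace d c (S T : 'M[R]_d) :
  possemidef (S - c%:M) -> possemidef T -> c * \tr T <= \tr (S *m T).
Proof.
move=> psdS psdT; have := psd_trace_mul_ge0 psdS psdT.
by rewrite mulmxBl raddfB /= mul_scalar_mx linearZ /= subr_ge0.
Qed.

Lemma psd_trace_ge0 d (S : 'M[R]_d) : possemidef S -> 0 <= \tr S.
Proof. by move=> /(psd_trace_mul_ge0 (psd1 R d)); rewrite mul1mx. Qed.

(** [S] is dominated by its trace because [v v^T <= |v|^2] and the form of [S] at
    [v] is [\tr (v v^T S)]. *)
Lemma psd_le_trace d (S : 'M[R]_d) : possemidef S -> possemidef ((\tr S)%:M - S).
Proof.
move=> psdS; have symS : symmetric S by case: psdS.
apply: psdI => [|v].
  by apply: symmetricD; [exact: symmetric_scalar | exact: symmetricN].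
rewrite mulmxBl mul_scalar_mx frobDr frobNr frobZr subr_ge0.
have psd_cs : possemidef ((frob v v)%:M - v *m v^T).
  apply: psdI => [|u].
    apply: symmetricD; first exact: symmetric_scalar.
    by apply: symmetricN; rewrite /symmetric trmx_mul trmxK.
  rewrite mulmxBl mul_scalar_mx frobDr frobNr frobZr subr_ge0.
  rewrite frob_outer -(real_normK (num_real _)) -!sqr_fnorm -exprMn.
  rewrite ler_pXn2r ?nnegrE ?mulr_ge0 ?fnorm_ge0//.
  exact: frob_cauchy_schwarz.
have := psd_trace_mul_ge0 psd_cs psdS.
rewrite mulmxBl raddfB /= mul_scalar_mx linearZ /= subr_ge0 mulrC.
by rewrite -mulmxA mxtrace_mulC /frob mulmxA.
Qed.

Lemma fnormM p q r (X : 'M[R]_(p, q)) (Y : 'M[R]_(q, r)) :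
  fnorm (X *m Y) <= fnorm X * fnorm Y.
Proof.
rewrite ler_fnorm ?fnorm_ge0// sqr_fnorm frob_mulmxl mulmxA.
have psdX : possemidef (X^T *m X) by rewrite -[X^T]mulmx1; exact/psd_congr/psd1.
exact/psd_upper/psd_le_trace.
Qed.

End TraceProduct.

(** * Extreme eigenvalues of symmetric matrices *)

Section Spectrum.
Variable R : realType.

Lemma posdef_unit d (S : 'M[R]_d) : posdef S -> S \in unitmx.
Proof.
move=> pdS; rewrite -row_free_unit -kermx_eq0; apply/rowV0P => u.
move=> /sub_kermxP uS0; apply/eqP; apply: contraT => u0.
have := posdef_frob (v := u^T) pdS; rewrite frob_cV trmxK mulmxA uS0 mul0mx mxE.
by rewrite ltxx; apply; rewrite -(inj_eq (@trmx_inj _ _ _)) trmxK trmx0.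
Qed.

Lemma posdef_inv d (S : 'M[R]_d) : posdef S -> posdef (invmx S).
Proof.
move=> pdS; have uS := posdef_unit pdS; have symS : S^T = S by case: pdS.
split=> [|v v0]; first exact: symmetric_inv.
rewrite -mulmxA -frob_cV -{1}[v](mulKVmx uS) frob_mulmxl symS posdef_frob//.
by apply: contra_neq v0 => Sv0; rewrite -[v](mulKVmx uS) Sv0 mulmx0.
Qed.

(** From Cauchy-Schwarz for the form of [S] at [X] and [S X]: this replaces the
    operator inequality [S^2 <= c S], and avoids square roots of matrices. *)
Lemma psd_mulmx_le d p c (S : 'M[R]_d) (X : 'M[R]_(d, p)) :
  possemidef S -> possemidef (c%:M - S) ->
  frob (S *m X) (S *m X) <= c * frob X (S *m X).
Proof.
move=> psdS upS; have symS : S^T = S by case: psdS.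
have := psd_cauchy_schwarz X (S *m X) psdS.
have -> : frob X (S *m (S *m X)) = frob (S *m X) (S *m X).
  by rewrite [RHS]frob_mulmxl symS.
have := psd_upper (S *m X) upS; have := psd_frob X psdS.
have := frob_ge0 (S *m X); set s := frob (S *m X) _; set q := frob X _.
rewrite le_eqVlt => /predU1P[<-|s0] q0 le1 le2.
  case: (ltrP c 0) => [c0|c0]; last by rewrite mulr_ge0.
  by have := psd_upper X upS; have := frob_ge0 X; rewrite -/q; nra.
have : s * s <= (c * q) * s by rewrite -expr2 (le_trans le2)// -mulrA mulrCA ler_wpM2l.
by rewrite ler_pM2r.
Qed.

(** [|v| <= |S^-1| |S v|] and [|S v|^2 <= \tr S <v, S v>] together bound the form
    of [S] below. *)
Lemma psd_unit_coercive d (S : 'M[R]_d) : possemidef S -> S \in unitmx ->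
  exists2 c : R, 0 < c & possemidef (S - c%:M).
Proof.
move=> psdS unitS; pose k := fnorm (invmx S) ^+ 2 * \tr S + 1.
have k_gt0 : 0 < k.
  by rewrite ltr_wpDl// mulr_ge0 ?sqr_ge0 ?psd_trace_ge0.
exists k^-1; first by rewrite invr_gt0.
apply/psd_lowerP => [|v]; first by case: psdS.
rewrite mulrC ler_pdivrMr// mulrC /k mulrDl mul1r -mulrA.
apply: le_trans (_ : fnorm (invmx S) ^+ 2 * frob (S *m v) (S *m v) <= _); last first.
  rewrite ler_wpDr ?psd_frob// ler_wpM2l ?sqr_ge0//.
  exact/psd_mulmx_le/psd_le_trace.
rewrite -ler_fnorm ?fnorm_ge0//.
by apply: le_trans (fnormM _ _); rewrite mulKmx.
Qed.

Lemma posdef_coercive d (S : 'M[R]_d) : posdef S ->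
  exists2 c : R, 0 < c & possemidef (S - c%:M).
Proof.
by move=> pdS; apply: psd_unit_coercive; [exact: posdef_psd | exact: posdef_unit].
Qed.

Lemma le_eigenvalue d c (S : 'M[R]_d) a :
  possemidef (S - c%:M) -> eigenvalue S a -> c <= a.
Proof.
move=> psdS /eigenvalueP[u uS u0].
have := psd_lower (u^T) psdS.
rewrite [frob _ (S *m _)]frob_cV trmxK mulmxA uS -scalemxAl mxE.
rewrite -[u in u *m _]trmxK -frob_cV.
by rewrite ler_pM2r// frob_gt0// -(inj_eq (@trmx_inj _ _ _)) trmxK trmx0.
Qed.

Lemma eigenvalue_gt0 d (S : 'M[R]_d) a : posdef S -> eigenvalue S a -> 0 < a.
Proof.
by move=> /posdef_coercive[c c0 psdS] /(le_eigenvalue psdS); exact: lt_le_trans.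
Qed.

(** The supremum [l] of the [c] with [c <= S] is attained.  If [l] were not an
    eigenvalue, [S - l] would be invertible, hence coercive, and [l] could be
    increased. *)
Lemma exists_least_eigenvalue d (S : 'M[R]_d) : (0 < d)%N -> symmetric S ->
  exists2 l, eigenvalue S l & possemidef (S - l%:M).
Proof.
move=> d_gt0 symS; pose E := [set c | possemidef (S - c%:M)].
have E0 : E (- fnorm S).
  apply/psd_lowerP => // v; rewrite mulNr lerNl.
  apply: le_trans (ler_norm _) _; rewrite normrN.
  apply: le_trans (frob_cauchy_schwarz _ _) _.
  rewrite -sqr_fnorm expr2 mulrC mulrA ler_wpM2r ?fnorm_ge0//.
  exact: fnormM.
pose e : 'cV[R]_d := delta_mx (Ordinal d_gt0) 0.
have e0 : e != 0.
  apply/eqP => /colP/(_ (Ordinal d_gt0)); rewrite !mxE !eqxx => /eqP.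
  by rewrite oner_eq0.
have ubE (v : 'cV[R]_d) : v != 0 -> ubound E (frob v (S *m v) / frob v v).
  move=> v0 c /(psd_lower v); rewrite ler_pdivlMr//.
  exact: frob_gt0.
have supE : has_sup E.
  split; first by exists (- fnorm S).
  by exists (frob e (S *m e) / frob e e); exact: ubE.
have El : E (sup E).
  apply/psd_lowerP => // v; have [->|v0] := eqVneq v 0.
    by rewrite mulmx0 /frob mulmx0 raddf0 mulr0.
  by rewrite -ler_pdivlMr ?frob_gt0//; apply: ge_sup; [case: supE | exact: ubE].
exists (sup E) => //.
rewrite /eigenvalue /eigenspace kermx_eq0 row_free_unit; apply/negP => unitSl.
have [c c_gt0 psdc] := psd_unit_coercive El unitSl.
have : E (sup E + c) by rewrite /E /= raddfD opprD addrA.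
by move=> /(ub_le_sup supE.2); rewrite gerDl leNgt c_gt0.
Qed.

Lemma lambda_minE d (S : 'M[R]_d) l :
  eigenvalue S l -> possemidef (S - l%:M) -> lambda_min S = l.
Proof.
move=> eigl psdl; apply/eqP; rewrite eq_le; apply/andP; split.
  by apply: ge_inf => //; exists l => a; exact: le_eigenvalue.
by apply: lb_le_inf; [exists l | move=> a; exact: le_eigenvalue].
Qed.

Lemma psd_dim0 (S : 'M[R]_0) : possemidef S.
Proof. by rewrite (flatmx0 S) -(flatmx0 1%:M); exact: psd1. Qed.

Lemma lambda_min_lower d (S : 'M[R]_d) :
  symmetric S -> possemidef (S - (lambda_min S)%:M).
Proof.
case: d S => [|d] S symS; first exact: psd_dim0.
have [l eigl psdl] := exists_least_eigenvalue (ltn0Sn d) symS.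
by rewrite (lambda_minE eigl).
Qed.

Lemma lambda_min_gt0 d (S : 'M[R]_d) : (0 < d)%N -> posdef S -> 0 < lambda_min S.
Proof.
move=> d_gt0 pdS; have [l eigl psdl] := exists_least_eigenvalue d_gt0 pdS.1.
by rewrite (lambda_minE eigl)// (eigenvalue_gt0 pdS).
Qed.

Lemma lambda_min_dim0 (S : 'M[R]_0) : lambda_min S = 0.
Proof.
rewrite /lambda_min (_ : [set a | _] = set0) ?inf0// -subset0 => a /=.
by move=> /eigenvalueP[u _]; rewrite thinmx0 eqxx.
Qed.

Lemma lambda_maxE d (S : 'M[R]_d) : lambda_max S = - lambda_min (- S).
Proof.
rewrite /lambda_min /inf opprK; congr sup; apply/seteqP; split=> a /=.
  move=> /eigenvalueP[u uS u0]; exists (- a); last by rewrite opprK.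
  by apply/eigenvalueP; exists u => //; rewrite mulmxN uS scaleNr.
move=> [b /eigenvalueP[u uS u0] <-]; apply/eigenvalueP; exists u => //.
by rewrite scaleNr -uS mulmxN opprK.
Qed.

Lemma lambda_max_upper d (S : 'M[R]_d) :
  symmetric S -> possemidef ((lambda_max S)%:M - S).
Proof.
move=> /symmetricN/lambda_min_lower; rewrite lambda_maxE addrC.
by set l := lambda_min _; rewrite [(- l)%:M](raddfN scalar_mx).
Qed.

End Spectrum.

(** * Norm bounds for products *)

Section OperatorNorm.
Variable R : realType.

Lemma specnorm_bound p q (A : 'M[R]_(p, q)) (v : 'cV[R]_q) :
  fnorm (A *m v) <= specnorm A * fnorm v.
Proof.
have [->|v0] := eqVneq v 0; first by rewrite mulmx0 !fnorm0 mulr0.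
have nv_gt0 := fnorm_gt0 v0.
rewrite -ler_pdivrMr// mulrC.
have -> : (fnorm v)^-1 * fnorm (A *m v) = fnorm (A *m ((fnorm v)^-1 *: v)).
  by rewrite -scalemxAr fnormZ ger0_norm ?invr_ge0 ?fnorm_ge0.
apply: ub_le_sup.
  exists (fnorm A) => _ [u /= u1 <-].
  by apply: le_trans (fnormM _ _) _; rewrite ler_piMr ?fnorm_ge0.
exists ((fnorm v)^-1 *: v) => //=.
by rewrite fnormZ ger0_norm ?invr_ge0 ?fnorm_ge0// mulVf ?gt_eqF.
Qed.

Lemma specnorm_ge0 p q (A : 'M[R]_(p, q)) : 0 <= specnorm A.
Proof.
apply: le_trans (_ : fnorm (A *m 0) <= _); first exact: fnorm_ge0.
apply: ub_le_sup; last by exists 0 => //=; rewrite fnorm0.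
exists (fnorm A) => _ [u /= u1 <-].
by apply: le_trans (fnormM _ _) _; rewrite ler_piMr ?fnorm_ge0.
Qed.

Lemma fnorm_specnorm_mulmx p q r (A : 'M[R]_(p, q)) (X : 'M[R]_(q, r)) :
  fnorm (A *m X) <= specnorm A * fnorm X.
Proof.
rewrite ler_fnorm ?specnorm_ge0// frob_mulmxl mulmxA.
apply: psd_upper; apply: psdI => [|v].
  apply: symmetricD; first exact: symmetric_scalar.
  by apply: symmetricN; rewrite /symmetric trmx_mul trmxK.
rewrite mulmxBl mul_scalar_mx frobDr frobNr frobZr subr_ge0.
by rewrite -mulmxA -frob_mulmxl -ler_fnorm ?specnorm_ge0// specnorm_bound.
Qed.

Lemma fnorm_invmx_mulmx d p c (S : 'M[R]_d) (X : 'M[R]_(d, p)) :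
  0 < c -> S \in unitmx -> possemidef (S - c%:M) ->
  fnorm (invmx S *m X) <= c^-1 * fnorm X.
Proof.
move=> c_gt0 unitS psdS; rewrite ler_pdivlMl//.
set Y := invmx S *m X; have -> : X = S *m Y by rewrite mulKVmx.
have [->|Y0] := eqVneq Y 0; first by rewrite mulmx0 fnorm0 mulr0.
rewrite -(ler_pM2r (fnorm_gt0 Y0)) -mulrA -expr2 sqr_fnorm mulrC.
rewrite [leRHS]mulrC; apply: le_trans (frob_cauchy_schwarz _ _).
by apply: le_trans (ler_norm _); rewrite mulrC psd_lower.
Qed.

Lemma fnorm_psd_mulmx d p c (S : 'M[R]_d) (X : 'M[R]_(d, p)) :
  0 <= c -> possemidef S -> possemidef (c%:M - S) ->
  fnorm (S *m X) <= c * fnorm X.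
Proof.
move=> c_ge0 psdS upS; rewrite ler_fnorm// expr2 -mulrA.
by apply: le_trans (psd_mulmx_le _ psdS upS) _; rewrite ler_wpM2l// psd_upper.
Qed.

Lemma invmx_lower d c (S : 'M[R]_d) : 0 < c -> posdef S ->
  possemidef (c%:M - S) -> possemidef (invmx S - c^-1%:M).
Proof.
move=> c_gt0 pdS upS; have unitS := posdef_unit pdS.
apply/psd_lowerP => [|v]; first by apply: symmetric_inv; case: pdS.
rewrite mulrC ler_pdivrMr// mulrC.
have := psd_mulmx_le (invmx S *m v) (posdef_psd pdS) upS.
by rewrite mulKVmx// [frob (invmx S *m v) v]frobC.
Qed.

End OperatorNorm.

(** * Second-order expansion of the trace of a weighted inverse *)

Section TraceInverse.
Variable R : realType.

Lemma invmxB d (P Q : 'M[R]_d) : P \in unitmx -> Q \in unitmx ->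
  invmx P - invmx Q = - (invmx P *m (P - Q) *m invmx Q).
Proof.
move=> uP uQ.
by rewrite mulmxBr mulVmx// mulmxBl mul1mx -mulmxA mulmxV// mulmx1 opprB.
Qed.

(** The resolvent identity applied twice, once on each side; it is exact, so the
    quadratic term carries the inverse at the displaced point. *)
Lemma invmx_expansion d (P D : 'M[R]_d) :
  P \in unitmx -> P + D \in unitmx ->
  invmx (P + D) = invmx P - invmx P *m D *m invmx P
                  + invmx P *m D *m invmx (P + D) *m D *m invmx P.
Proof.
move=> uP uPD; set K := invmx (P + D); set Z := invmx P.
have KZ : K = Z - Z *m D *m K.
  have := invmxB uP uPD; rewrite opprD addNKr mulmxN mulNmx opprK -/K -/Z.
  by move=> <-; rewrite opprB addrC subrK.
have ZK : K = Z - K *m D *m Z.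
  have := invmxB uPD uP; rewrite addrAC subrr add0r -/K -/Z => /eqP.
  by rewrite subr_eq addrC => /eqP.
rewrite {1}KZ {1}ZK mulmxBr !mulmxA opprB.
by rewrite addrCA addrC.
Qed.

Section Objective.
Variables (d : nat) (W S0 : 'M[R]_d).
Hypotheses (W_pd : posdef W) (S0_pd : posdef S0).

Let symW : W^T = W. Proof. by case: W_pd. Qed.

Lemma fgrad_symmetric S : symmetric S -> symmetric (fgrad W S0 S).
Proof.
move=> symS; apply: symmetricN.
have /symmetric_inv symP : symmetric (S0 + S).
  by apply: symmetricD => //; case: S0_pd.
by rewrite -{1}symP; apply: symmetric_congr.
Qed.

(** The inner product is split in the middle of
    [W P^-1 D (P + D)^-1 D P^-1] so that Cauchy-Schwarz applies directly; the
    symmetric form is [remainder_trace]. *)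
Definition remainder (S D : 'M[R]_d) : R :=
  frob (D *m invmx (S0 + S) *m W) (invmx (S0 + S + D) *m D *m invmx (S0 + S)).

Lemma fobj_expansion S D : symmetric S -> symmetric D ->
  S0 + S \in unitmx -> S0 + S + D \in unitmx ->
  fobj W S0 (S + D) = fobj W S0 S + frob (fgrad W S0 S) D + remainder S D.
Proof.
move=> symS symD uP uPD.
have symZ : (invmx (S0 + S))^T = invmx (S0 + S).
  by apply: symmetric_inv; apply: symmetricD => //; case: S0_pd.
rewrite /fobj /remainder frob_trace; last exact: fgrad_symmetric.
rewrite /frob !trmx_mul symW symZ symD addrA.
rewrite [in LHS](invmx_expansion uP uPD).
rewrite mulmxDr mulmxBr raddfD raddfB /= mulNmx raddfN /= !mulmxA.
congr (_ - _ + _); by rewrite [LHS]mxtrace_mulC !mulmxA.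
Qed.

Lemma remainder_trace S D : symmetric S -> symmetric D ->
  remainder S D =
  \tr (W *m ((D *m invmx (S0 + S))^T *m invmx (S0 + S + D)
            *m (D *m invmx (S0 + S)))).
Proof. by move=> symS symD; rewrite /remainder /frob trmx_mul symW !mulmxA. Qed.

Lemma remainder_ge0 S D : symmetric S -> symmetric D ->
  posdef (S0 + S + D) -> 0 <= remainder S D.
Proof.
move=> symS symD pdPD; rewrite remainder_trace//.
apply: psd_trace_mul_ge0; first exact: posdef_psd.
exact/psd_congr/posdef_psd/posdef_inv.
Qed.

(** The factors are peeled off one at a time: [W >= w], then
    [(P + D)^-1 >= M^-1], then [|D| = |P (P^-1 D)| <= M |P^-1 D|], which costs
    [M^2] after squaring. *)
Lemma remainder_lower S D M w : symmetric S -> symmetric D ->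
  posdef (S0 + S) -> posdef (S0 + S + D) ->
  0 < M -> possemidef (M%:M - (S0 + S)) -> possemidef (M%:M - (S0 + S + D)) ->
  0 <= w -> possemidef (W - w%:M) ->
  w / M ^+ 3 * fnorm D ^+ 2 <= remainder S D.
Proof.
move=> symS symD pdP pdPD M_gt0 upP upPD w_ge0 loW.
have symZ : (invmx (S0 + S))^T = invmx (S0 + S) by apply: symmetric_inv; case: pdP.
have loK := invmx_lower M_gt0 pdPD upPD.
have psdK := posdef_psd (posdef_inv pdPD).
rewrite remainder_trace//; apply: le_trans (psd_lower_trace loW (psd_congr _ psdK)).
rewrite -mulrA ler_wpM2l//; set Y := D *m _.
rewrite -mulmxA -/(frob Y _).
apply: le_trans (psd_lower Y loK).
have : fnorm D <= M * fnorm Y.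
  have := fnorm_psd_mulmx Y^T (ltW M_gt0) (posdef_psd pdP) upP.
  by rewrite fnorm_tr /Y trmx_mul symZ symD mulKVmx ?posdef_unit.
rewrite ler_fnorm ?(ltW M_gt0)// sqr_fnorm => leD.
rewrite exprS invfM -mulrA ler_wpM2l ?invr_ge0 ?(ltW M_gt0)//.
by rewrite mulrC ler_pdivrMr ?exprn_gt0// mulrC.
Qed.

Lemma remainder_upper S D c : symmetric S -> symmetric D -> 0 < c ->
  posdef (S0 + S + D) -> possemidef (S0 + S + D - c%:M) ->
  remainder S D <= fnorm (invmx (S0 + S) *m W) * (c^-1 * fnorm (invmx (S0 + S)))
                   * fnorm D ^+ 2.
Proof.
move=> symS symD c_gt0 pdPD loPD.
apply: le_trans (ler_norm _) _; apply: le_trans (frob_cauchy_schwarz _ _) _.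
set Z := invmx (S0 + S); set K := invmx _.
have le1 : fnorm (D *m Z *m W) <= fnorm D * fnorm (Z *m W).
  by rewrite -mulmxA fnormM.
have le2 : fnorm (K *m D *m Z) <= c^-1 * (fnorm D * fnorm Z).
  rewrite -mulmxA; apply: le_trans (fnorm_invmx_mulmx _ c_gt0 (posdef_unit pdPD) loPD) _.
  by rewrite ler_wpM2l ?fnormM// invr_ge0 ltW.
apply: le_trans (ler_pM _ _ le1 le2) _; rewrite ?fnorm_ge0//.
by rewrite le_eqVlt; apply/orP; left; apply/eqP; ring.
Qed.

(** If [2 h <= P], then [h <= P + D] as soon as [|D| <= h], so the remainder is
    at most [k |D|^2] with [k] independent of [D]. *)
Lemma fgrad_is_gradient S : possemidef S -> is_gradient (fobj W S0) S (fgrad W S0 S).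
Proof.
move=> psdS; have symS : symmetric S by case: psdS.
split=> [|e e_gt0]; first exact: fgrad_symmetric.
have pdP : posdef (S0 + S) by apply: posdefD.
have [c c_gt0 loP] := posdef_coercive pdP.
pose k := fnorm (invmx (S0 + S) *m W) * ((c / 2)^-1 * fnorm (invmx (S0 + S))).
have c2_gt0 : 0 < c / 2 by rewrite divr_gt0.
have k_ge0 : 0 <= k by rewrite !mulr_ge0 ?fnorm_ge0// invr_ge0 ltW.
exists (Num.min (c / 2) (e / (k + 1))).
  by rewrite lt_min c2_gt0 divr_gt0// ltr_wpDl.
move=> D symD; rewrite lt_min => /andP[D_lt1 D_lt2].
have loPD : possemidef (S0 + S + D - (c / 2)%:M).
  apply/psd_lowerP => [|v].
    by apply: symmetricD => //; case: pdP.
  rewrite mulmxDl frobDr.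
  have le1 := psd_lower v loP.
  have : `|frob v (D *m v)| <= c / 2 * frob v v.
    apply: le_trans (frob_cauchy_schwarz _ _) _.
    rewrite -sqr_fnorm expr2 mulrC mulrA ler_wpM2r ?fnorm_ge0//.
    apply: le_trans (fnormM _ _) _.
    by rewrite ler_wpM2r ?fnorm_ge0// ltW.
  by rewrite ler_norml => /andP[le2 _]; lra.
have pdPD : posdef (S0 + S + D).
  split=> [|v v0]; first by apply: symmetricD => //; case: pdP.
  rewrite -mulmxA -frob_cV; apply: lt_le_trans (psd_lower v loPD).
  by rewrite mulr_gt0 ?frob_gt0.
rewrite fobj_expansion ?posdef_unit//.
rewrite [X in `|X|](_ : _ = remainder S D); last by ring.
rewrite ger0_norm ?remainder_ge0//.
apply: le_trans (remainder_upper symS symD c2_gt0 pdPD loPD) _.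
rewrite -/k expr2 mulrA ler_wpM2r ?fnorm_ge0//.
have k1_gt0 : 0 < k + 1 by rewrite ltr_wpDl.
move: D_lt2; rewrite ltr_pdivlMr// => D_lt2.
by have := fnorm_ge0 D; nra.
Qed.

Lemma fgrad_negdef S : possemidef S -> negdef (fgrad W S0 S).
Proof.
move=> psdS; rewrite /negdef /fgrad opprK.
have pdP : posdef (S0 + S) by apply: posdefD.
have pdZ := posdef_inv pdP.
have symZ : (invmx (S0 + S))^T = invmx (S0 + S) by case: pdZ.
split=> [|v v0]; first by rewrite -{1}symZ; apply: symmetric_congr.
rewrite -!mulmxA -frob_cV -{1}symZ -frob_mulmxl posdef_frob//.
apply: contra_neq v0 => Zv0; rewrite -[v](mulKVmx (posdef_unit pdP)) Zv0.
by rewrite mulmx0.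
Qed.

(** With [Z = (S0 + X)^-1] and [K = (S0 + Y)^-1],
    [Z W Z - K W K = (Z - K) W Z + K W (Z - K)] and [Z - K = - Z (X - Y) K]. *)
Lemma fgrad_lipschitz X Y l : 0 < l -> possemidef (S0 - l%:M) ->
  possemidef X -> possemidef Y ->
  fnorm (fgrad W S0 X - fgrad W S0 Y) <= 2 * specnorm W / l ^+ 3 * fnorm (X - Y).
Proof.
move=> l_gt0 loS0 psdX psdY.
have pdP : posdef (S0 + X) by apply: posdefD.
have pdQ : posdef (S0 + Y) by apply: posdefD.
have loP : possemidef (S0 + X - l%:M) by rewrite addrAC; apply: psdD.
have loQ : possemidef (S0 + Y - l%:M) by rewrite addrAC; apply: psdD.
have [uP uQ] := (posdef_unit pdP, posdef_unit pdQ).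
have symZ : (invmx (S0 + X))^T = invmx (S0 + X) by case: (posdef_inv pdP).
have symK : (invmx (S0 + Y))^T = invmx (S0 + Y) by case: (posdef_inv pdQ).
have leZ p (N : 'M[R]_(d, p)) := fnorm_invmx_mulmx N l_gt0 uP loP.
have leK p (N : 'M[R]_(d, p)) := fnorm_invmx_mulmx N l_gt0 uQ loQ.
set s := specnorm W; have s_ge0 : 0 <= s := specnorm_ge0 W.
have leW p (N : 'M[R]_(d, p)) : fnorm (W *m N) <= s * fnorm N.
  exact: fnorm_specnorm_mulmx.
have symXY : (X - Y)^T = X - Y.
  by apply: symmetricD; [case: psdX | apply: symmetricN; case: psdY].
have := invmxB uP uQ; rewrite opprD addrACA subrr add0r.
rewrite /fgrad; set Z := invmx (S0 + X) in symZ leZ *.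
set K := invmx (S0 + Y) in symK leK *; set D := X - Y in symXY * => ZK.
have -> : - (Z *m W *m Z) - - (K *m W *m K) =
    Z *m (D *m K *m W *m Z) + K *m W *m (Z *m (D *m K)).
  have -> : Z *m (D *m K *m W *m Z) = - ((Z - K) *m W *m Z).
    by rewrite ZK !mulNmx opprK !mulmxA.
  have -> : K *m W *m (Z *m (D *m K)) = - (K *m W *m (Z - K)).
    by rewrite ZK mulmxN opprK !mulmxA.
  by rewrite mulmxBr !mulmxBl !opprB opprK [LHS]addrC [RHS]addrC addrA subrK.
have li_ge0 : 0 <= l^-1 by rewrite invr_ge0 ltW.
have DK : fnorm (D *m K) <= l^-1 * fnorm D.
  by rewrite -fnorm_tr trmx_mul symK symXY.
have le1 : fnorm (Z *m (D *m K *m W *m Z)) <= l^-1 * (l^-1 * (s * (l^-1 * fnorm D))).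
  apply: le_trans (leZ _ _) _; rewrite ler_wpM2l//.
  rewrite -fnorm_tr trmx_mul symZ; apply: le_trans (leZ _ _) _; rewrite ler_wpM2l//.
  rewrite trmx_mul symW; apply: le_trans (leW _ _) _; rewrite ler_wpM2l//.
  by rewrite fnorm_tr.
have le2 : fnorm (K *m W *m (Z *m (D *m K))) <= l^-1 * (s * (l^-1 * (l^-1 * fnorm D))).
  rewrite -mulmxA; apply: le_trans (leK _ _) _; rewrite ler_wpM2l//.
  apply: le_trans (leW _ _) _; rewrite ler_wpM2l//.
  by apply: le_trans (leZ _ _) _; rewrite ler_wpM2l.
apply: le_trans (fnormD _ _) _; apply: le_trans (lerD le1 le2) _.
by rewrite le_eqVlt; apply/orP; left; apply/eqP; field; lra.
Qed.

(** Average the expansions at [Z = t X + (1 - t) Y] towards [X] and [Y] with weights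
    [t] and [1 - t]: the linear terms cancel, and
    [t (1 - t)^2 + (1 - t) t^2 = t (1 - t)].  [K] is not assumed
    convex, so the premise covers expansion points outside [K]. *)
Lemma strongly_convex_of_remainder (K : set 'M[R]_d) c :
  (forall X, K X -> possemidef X) ->
  (forall X Y t, K X -> K Y -> 0 <= t <= 1 ->
    forall V Z, K V -> Z = t *: X + (1 - t) *: Y ->
    c / 2 * fnorm (V - Z) ^+ 2 <= remainder Z (V - Z)) ->
  strongly_convex_on K c (fobj W S0).
Proof.
move=> psdK lowK X Y t KX KY /[dup] t01 /andP[t0 t1]; set Z := _ + _.
have psdX := psdK _ KX; have psdY := psdK _ KY.
have psdZ : possemidef Z by apply: psdD; apply: psdZ => //; rewrite subr_ge0.
have symZ : symmetric Z by case: psdZ.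
have tangent V : K V -> fobj W S0 Z + frob (fgrad W S0 Z) (V - Z)
    + c / 2 * fnorm (V - Z) ^+ 2 <= fobj W S0 V.
  move=> KV; have psdV := psdK _ KV.
  have eV : V = Z + (V - Z) by rewrite addrC subrK.
  rewrite [in leRHS]eV (@fobj_expansion Z (V - Z))//.
  - by rewrite lerD2l; apply: (lowK X Y t).
  - by apply: symmetricD; [case: psdV | apply: symmetricN].
  - exact/posdef_unit/posdefD.
  - by rewrite -addrA -eV; exact/posdef_unit/posdefD.
have XZ : X - Z = (1 - t) *: (X - Y).
  by rewrite /Z scalerBr opprD addrA !scalerBl !scale1r.
have YZ : Y - Z = - t *: (X - Y).
  by rewrite /Z scaleNr scalerBr scalerBl scale1r opprB opprD opprB addrCA subrKC addrC.
have := tangent X KX; have := tangent Y KY.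
rewrite XZ YZ !fnormZ !frobZr !exprMn !real_normK ?num_real//.
set g := frob _ _; set n2 := fnorm _ ^+ 2; set fX := fobj _ _ X; set fY := fobj _ _ Y.
set fZ := fobj _ _ Z => leY leX.
have t1' : 0 <= 1 - t by rewrite subr_ge0.
have := lerD (ler_wpM2l t0 leX) (ler_wpM2l t1' leY).
by rewrite -/n2 -/fX -/fY -/fZ; lra.
Qed.

End Objective.
End TraceInverse.

(** * Semidefiniteness of covariances *)

Section ExpectationPsd.
Variables (R : realType) (d : measure_display) (T : measurableType d).
Variable P : probability T R.

(** The quadratic form of the expectation is the expectation of the quadratic form. *)
Lemma mx_expectation_psd p (M : T -> 'M[R]_p) : mx_integrable P M ->
  (forall o, possemidef (M o)) -> possemidef (mx_expectation P M).
Proof.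
move=> intM psdM; apply: psdI => [|v].
  apply/matrixP => i j; rewrite !mxE; congr (fine 'E_P[_]).
  by apply/funext => o; have /matrixP/(_ i j) := (psdM o).1; rewrite mxE.
have -> : frob v (mx_expectation P M *m v) =
    fine (\int[P]_o (frob v (M o *m v))%:E)%E.
  have qE N : frob v (N *m v) =
      \sum_(ij : 'I_p * 'I_p) (v ij.1 0 * v ij.2 0) * N ij.1 ij.2.
    rewrite frobE big_ord1 -(pair_bigA _ (fun i j => v i 0 * v j 0 * N i j)) /=.
    apply: eq_bigr => i _; rewrite mxE mulr_sumr; apply: eq_bigr => j _; ring.
  have intE (c : R) (ij : 'I_p * 'I_p) :
      (\int[P]_o (c * M o ij.1 ij.2)%:E)%E = (c * mx_expectation P M ij.1 ij.2)%:E.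
    under eq_integral do rewrite EFinM.
    rewrite (integralZl measurableT (intM ij.1 ij.2)) EFinM mxE unlock fineK//.
    exact: integrable_fin_num (intM ij.1 ij.2).
  under eq_integral do rewrite qE -sumEFin.
  rewrite integral_sum// => [|ij].
    by under eq_bigr do rewrite intE; rewrite sumEFin qE.
  by under eq_fun do rewrite EFinM; apply: (integrableZl _ _ (intM ij.1 ij.2)).
by rewrite fine_ge0// integral_ge0// => o _; rewrite lee_fin psd_frob.
Qed.

End ExpectationPsd.

Lemma covariance_psd (R : realType) n m H (A : 'M[R]_n) (B : 'M[R]_(n, m))
    (nu : probability (vec R n) R) S :
  covariances H A B nu S -> possemidef S.
Proof.
move=> [pi [d [T [P [x [w [u [_ intS ->]]]]]]]].
apply: mx_expectation_psd => // o.
apply: (big_ind (@possemidef R (n + m))) => [|X Y|t _].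
- by rewrite -(scale0r 1%:M); apply: psdZ => //; exact: psd1.
- exact: psdD.
- exact: psd_outer.
Qed.

(** * Strong convexity *)

Lemma strongly_convex_on_psd (R : realType) d (W S0 : 'M[R]_d) :
  posdef W -> posdef S0 ->
  strongly_convex_on [set S | possemidef S] 0 (fobj W S0).
Proof.
move=> pdW pdS0; apply: strongly_convex_of_remainder => // X Y t psdX psdY.
move=> /andP[t0 t1] V Z psdV ZE; rewrite mul0r mul0r.
have psdZ' : possemidef Z.
  by rewrite ZE; apply: psdD; apply: psdZ => //; rewrite subr_ge0.
have [symZ symV] := (psdZ'.1, psdV.1).
apply: remainder_ge0 => //; first exact/symmetricD/symmetricN.
by rewrite -addrA [Z + _]addrC subrK; exact: posdefD.
Qed.

Lemma psd_budget_upper (R : realType) d (W S : 'M[R]_d) (mu beta : R) : 0 < mu ->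
  possemidef (W - mu%:M) -> possemidef S -> \tr (W *m S) <= beta ->
  possemidef ((beta / mu)%:M - S).
Proof.
move=> mu_gt0 loW psdS leb.
have -> : (beta / mu)%:M - S = (\tr S)%:M - S + (beta / mu - \tr S) *: 1%:M.
  by rewrite scalemx1 [(beta / mu - _)%:M]raddfB /= [RHS]addrC addrA subrK.
apply: psdD; first exact: psd_le_trace.
apply: psdZ; last exact: psd1.
rewrite subr_ge0 ler_pdivlMr// mulrC.
exact: le_trans (psd_lower_trace loW psdS) leb.
Qed.

(** In dimension zero the spectrum is empty and the constant is zero, so the claim
    reduces to convexity; in positive dimension [mu] is positive, and so is the
    upper bound [M] as soon as [K] has a point. *)
Lemma strongly_convex_on_budget (R : realType) d (W S0 W2 : 'M[R]_d) (beta : R)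
    (K : set 'M[R]_d) :
  posdef W -> posdef S0 -> posdef W2 ->
  (forall S, K S -> possemidef S /\ \tr (W2 *m S) <= beta) ->
  strongly_convex_on K
    (2 * lambda_min W / (lambda_max S0 + beta / lambda_min W2) ^+ 3) (fobj W S0).
Proof.
case: d W S0 W2 K => [|d] W S0 W2 K pdW pdS0 pdW2 budgetK.
  rewrite lambda_min_dim0 mulr0 mul0r => X Y t KX KY.
  by apply: strongly_convex_on_psd => //; exact: (budgetK _ _).1.
set mu := lambda_min W2; set M := _ + _.
have mu_gt0 : 0 < mu by exact: lambda_min_gt0.
have w_gt0 := lambda_min_gt0 (ltn0Sn d) pdW.
apply: strongly_convex_of_remainder => // [S /budgetK[]//|X Y t KX KY].
move=> /andP[t0 t1] V Z KV ZE.
have up S : possemidef S -> \tr (W2 *m S) <= beta -> possemidef (M%:M - (S0 + S)).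
  move=> psdS leS; rewrite /M raddfD /= opprD addrACA.
  apply: psdD; first by apply: lambda_max_upper; case: pdS0.
  by apply: psd_budget_upper leS => //; apply: lambda_min_lower; case: pdW2.
have [psdX leX] := budgetK _ KX; have [psdY leY] := budgetK _ KY.
have [psdV leV] := budgetK _ KV.
have t1' : 0 <= 1 - t by rewrite subr_ge0.
have psdZ' : possemidef Z by rewrite ZE; apply: psdD; apply: psdZ.
have leZ : \tr (W2 *m Z) <= beta.
  rewrite ZE mulmxDr -!scalemxAr raddfD /= !mxtraceZ.
  have := lerD (ler_wpM2l t0 leX) (ler_wpM2l t1' leY).
  by rewrite -mulrDl subrKC mul1r.
have ZVZ : S0 + Z + (V - Z) = S0 + V by rewrite -addrA [Z + _]addrC subrK.
have M_gt0 : 0 < M.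
  have v0 : (delta_mx 0 0 : 'cV[R]_d.+1) != 0.
    by apply/eqP => /colP/(_ 0); rewrite !mxE !eqxx => /eqP; rewrite oner_eq0.
  (* the form of [S0 + X] at a nonzero vector is positive and at most [M] times
     the square of its norm *)
  have := lt_le_trans (posdef_frob (posdefD pdS0 psdX) v0)
    (psd_upper _ (up _ psdX leX)).
  by rewrite pmulr_lgt0// frob_gt0.
rewrite [X in X * _](_ : _ = lambda_min W / M ^+ 3); last first.
  by field; rewrite gt_eqF.
have [symZ symV] := (psdZ'.1, psdV.1).
apply: remainder_lower; rewrite ?ZVZ ?(ltW w_gt0)//.
- exact/symmetricD/symmetricN.
- exact: posdefD.
- exact: posdefD.
- exact: up.
- exact: up.
- by apply: lambda_min_lower; case: pdW.
Qed.

Theorem lemma2 (R : realType) (n m H : nat) (H_gt0 : (0 < H)%N)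
    (A : 'M[R]_n) (B : 'M[R]_(n, m))
    (nu : probability (vec R n) R) (Sw : 'M[R]_n)
    (nu_mean : zero_mean nu) (nu_cov : has_covariance nu Sw)
    (W1 W2 S0 : 'M[R]_(n + m)) (beta b0 : R)
    (Sw_pd : posdef Sw) (W1_pd : posdef W1) (W2_pd : posdef W2)
    (S0_pd : posdef S0) (beta_gt0 : 0 < beta)
    (b0_min : is_minimum [set \tr (W2 *m S) | S in covariances H A B nu] b0)
    (b0_lt : b0 < beta) :
  let f := fobj W1 S0 in
  let L := 2 * specnorm W1 / lambda_min S0 ^+ 3 in
  let mu := lambda_min W2 in
  let mf := 2 * lambda_min W1 / (lambda_max S0 + beta / mu) ^+ 3 in
  [/\ convex_function [set S : 'M[R]_(n + m) | possemidef S] f,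
      forall S : 'M[R]_(n + m), possemidef S ->
        is_gradient f S (fgrad W1 S0 S) /\ negdef (fgrad W1 S0 S),
      forall X Y : 'M[R]_(n + m), possemidef X -> possemidef Y ->
        fnorm (fgrad W1 S0 X - fgrad W1 S0 Y) <= L * fnorm (X - Y) &
      strongly_convex_on (budgeted_covariances H A B nu W2 beta) mf f].
Proof.
have symS0 : symmetric S0 by case: S0_pd.
split.
- move=> t X Y; rewrite !inE /= => psdX psdY.
  have t01 : 0 <= t%:num <= 1 by apply/andP.
  have := strongly_convex_on_psd W1_pd S0_pd psdX psdY t01.
  by rewrite !mul0r subr0.
- by move=> S psdS; split; [exact: fgrad_is_gradient | exact: fgrad_negdef].
- move=> X Y psdX psdY; have [d0|d_gt0] := posnP (n + m).
    (* here [L] is [0 / 0], but there is only one matrix *)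
    have dim0 (N : 'M[R]_(n + m)) : N = 0.
      by move: N; rewrite d0 => N; exact: flatmx0.
    by rewrite (dim0 (_ - fgrad _ _ _)) (dim0 (X - Y)) !fnorm0 mulr0.
  apply: fgrad_lipschitz => //; first exact: lambda_min_gt0.
  exact: lambda_min_lower.
- apply: strongly_convex_on_budget => // S [covS leS]; split=> //.
  exact: covariance_psd covS.
Qed.
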